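(* Let $\lambda,\mu,\rho,\omega>0$ be fixed and set $C_p=\sqrt{(\lambda+2\mu)/\rho}$, $C_s=\sqrt{\mu/\rho}$. For $\delta>0$ and $k\in\mathbb{R}$ let $r_\pm=r_\pm(k,\omega,C_p,C_s,\delta)$ be the eigenvalues of the double-iteration matrix of the classical Schwarz method with overlap $\delta$ applied to the time-harmonic Navier equations, as given in the context, so that the convergence factor is $\max\{|r_+|,|r_-|\}$. Then the maximum over $k$ of the convergence factor behaves for small overlap asymptotically as $$\max_{k}\left(\max|r_\pm|\right)=1+\frac{\sqrt{2}\,C_s\,\omega\left(3C_p^2-\sqrt{C_p^4+8C_s^4}\right)\sqrt{C_p^2\sqrt{C_p^4+8C_s^4}-C_p^4-2C_s^4}}{C_p\,(C_p^2+C_s^2)^{3/2}\left(\sqrt{C_p^4+8C_s^4}-C_p^2\right)}\,\delta+o(\delta)\qquad(\delta\to0^+).$$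
   Context: The time-harmonic Navier equations are $-(\Delta^e+\omega^2\rho)\mathbf{u}=\mathbf{f}$ with $\Delta^e\mathbf{u}=\mu\Delta\mathbf{u}+(\lambda+\mu)\nabla(\nabla\cdot\mathbf{u})$, posed on $\mathbb{R}^2$, with Lamé coefficients $\lambda,\mu$, density $\rho$ and frequency $\omega$. The classical parallel Schwarz method uses the subdomains $\Omega_1=(-\infty,\delta)\times\mathbb{R}$ and $\Omega_2=(0,\infty)\times\mathbb{R}$ and, for $n=1,2,\dots$, solves the equation for $\mathbf u_1^n$ in $\Omega_1$ with $\mathbf u_1^n=\mathbf u_2^{n-1}$ on $x=\delta$, and for $\mathbf u_2^n$ in $\Omega_2$ with $\mathbf u_2^n=\mathbf u_1^{n-1}$ on $x=0$. The variable $k\in\mathbb{R}$ is the Fourier variable in the $y$ direction. The convergence factor of the Fourier mode $k$ (spectral radius of the iteration matrix over a double iteration) is $\rho_{cla}(k,\omega,C_p,C_s,\delta)=\max\{|r_+|,|r_-|\}$, where $$r_\pm=\frac{X^2}{2}+e^{-\delta(\lambda_1+\lambda_2)}\pm\frac12\sqrt{X^2\left(X^2+4e^{-\delta(\lambda_1+\lambda_2)}\right)},\qquad X=\frac{k^2+\lambda_1\lambda_2}{k^2-\lambda_1\lambda_2}\left(e^{-\lambda_1\delta}-e^{-\lambda_2\delta}\right),$$ $$\lambda_1=\sqrt{k^2-\frac{\omega^2}{C_s^2}},\qquad \lambda_2=\sqrt{k^2-\frac{\omega^2}{C_p^2}}.$$ The square roots are principal complex square roots (for negative radicand, $i$ times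 a positive real). The notation $\max|r_\pm|$ means $\max\{|r_+|,|r_-|\}$, and $\max_k$ is the maximum over all Fourier frequencies $k\in\mathbb{R}$. *)

(* Defs.v *)
From mathcomp Require Import all_boot all_order all_algebra.
From mathcomp Require Import all_classical all_reals all_analysis.
From mathcomp Require Import complex.

Set Implicit Arguments.
Unset Strict Implicit.
Unset Printing Implicit Defensive.

Import Order.TTheory GRing.Theory Num.Theory.
Import numFieldNormedType.Exports.

Local Open Scope ring_scope.
Local Open Scope complex_scope.

Section ClassicalSchwarzNavier.
Context {R : realType}.
Implicit Types lambda mu rho omega Cp Cs delta k : R.

Definition cexp (z : R[i]) : R[i] :=
  expR (complex.Re z) * cos (complex.Im z)
  +i* (expR (complex.Re z) * sin (complex.Im z)).

Definition speed_p lambda mu rho := Num.sqrt ((lambda + 2 * mu) / rho).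
Definition speed_s mu rho := Num.sqrt (mu / rho).

(* [sqrtc] is the principal square root: its value has nonnegative real part,
   and is [i] times a positive real on the negative real axis. *)
Definition lambda1 k omega Cs : R[i] :=
  sqrtc (k ^+ 2 - omega ^+ 2 / Cs ^+ 2)%:C.
Definition lambda2 k omega Cp : R[i] :=
  sqrtc (k ^+ 2 - omega ^+ 2 / Cp ^+ 2)%:C.

(* Only used with [0 < Cs < Cp] and [0 < omega], in which case the denominator
   [k^2 - lambda1 lambda2] does not vanish for any real [k]. *)
Definition schwarz_X k omega Cp Cs delta : R[i] :=
  let l1 := lambda1 k omega Cs in
  let l2 := lambda2 k omega Cp in
  (k%:C ^+ 2 + l1 * l2) / (k%:C ^+ 2 - l1 * l2)
  * (cexp (- (l1 * delta%:C)) - cexp (- (l2 * delta%:C))).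

Definition schwarz_E k omega Cp Cs delta : R[i] :=
  cexp (- (delta%:C * (lambda1 k omega Cs + lambda2 k omega Cp))).

(* Closed form of the two eigenvalues of the matrix that maps the error
   coefficients of the Fourier mode [k] (dual to [y]) over two iterations of
   the parallel Schwarz method on [x < delta] and [x > 0] for the
   time-harmonic Navier equations. *)
Definition r_plus k omega Cp Cs delta : R[i] :=
  let X := schwarz_X k omega Cp Cs delta in
  let E := schwarz_E k omega Cp Cs delta in
  X ^+ 2 / 2 + E + 1 / 2 * sqrtc (X ^+ 2 * (X ^+ 2 + 4 * E)).
Definition r_minus k omega Cp Cs delta : R[i] :=
  let X := schwarz_X k omega Cp Cs delta in
  let E := schwarz_E k omega Cp Cs delta in
  X ^+ 2 / 2 + E - 1 / 2 * sqrtc (X ^+ 2 * (X ^+ 2 + 4 * E)).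

Definition rho_cla k omega Cp Cs delta : R :=
  Num.max (ComplexField.Normc.normc (r_plus k omega Cp Cs delta))
          (ComplexField.Normc.normc (r_minus k omega Cp Cs delta)).

Definition is_maximum (f : R -> R) (m : R) : Prop :=
  (exists x, f x = m) /\ (forall x, f x <= m).

End ClassicalSchwarzNavier.

(* Main.v *)
Require Import Defs.
From mathcomp Require Import all_boot all_order all_algebra.
From mathcomp Require Import all_classical all_reals all_analysis.
From mathcomp Require Import complex ring lra.
Import Order.TTheory GRing.Theory Num.Theory.
Import numFieldNormedType.Exports.
Import ComplexField.Normc.
Local Open Scope classical_set_scope.
Local Open Scope ring_scope.

Set Implicit Arguments.
Unset Strict Implicit.

(* With [q = (k^2 + l1 l2) / (k^2 - l1 l2)], [w = exp (- (l1 + l2) delta / 2)]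
   and [y = q sinh ((l2 - l1) delta / 2)] one has [X = 2 w y] and [E = w^2], so
   the eigenvalues are [w^2 (y +- sqrt (1 + y^2))^2] and the convergence factor
   is [|w|^2 exp (2 |Re (arcsinh y)|)]. In elliptic coordinates the second
   factor is [H + sqrt (H^2 - 1)] with [H = |y|^2 + |1 + y^2|], a real formula
   that does not involve branches of the complex square root.
   Put [a = omega^2 / Cs^2] and [b = omega^2 / Cp^2], so that [b < a]. For
   [k^2 <= b] the number [y] is imaginary with [|y| <= 1] and the factor is at
   most [1]; for [a <= k^2] the number [y] is real and [sinh (r v) >= r sinh v]
   ([r >= 1], [v >= 0]) bounds the factor by [1] again. For [b <= k^2 <= a] the
   factor is [1 + g(k) delta + O(delta^2)] uniformly in [k], where, with
   [t = sqrt (k^2 - b)], [g = 2 b t (a - b - t^2) / ((a + b) t^2 + b^2)].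
   The constant of the expansion is the maximum of [g], attained where a
   biquadratic equation in [t] holds. *)

(** * Complex moduli and the larger eigenvalue modulus *)

Section Cexp.
Variable R : realType.
Local Open Scope complex_scope.
Implicit Types z w : R[i].

Lemma normc_sqr z : normc z ^+ 2 = complex.Re z ^+ 2 + complex.Im z ^+ 2.
Proof. by case: z => x y /=; rewrite sqr_sqrtr// addr_ge0// sqr_ge0. Qed.

Lemma normc_ge0 z : 0 <= normc z.
Proof. by case: z => x y; exact: sqrtr_ge0. Qed.

Lemma parallelogramc z w :
  normc (z + w) ^+ 2 + normc (z - w) ^+ 2 = 2 * (normc z ^+ 2 + normc w ^+ 2).
Proof.
rewrite !normc_sqr; case: z w => [x y] [u v] /=; ring.
Qed.

Lemma normcX z n : normc (z ^+ n) = normc z ^+ n.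
Proof.
by elim: n => [|n IH]; rewrite ?expr0 ?normc1// !exprS normcM IH.
Qed.

Lemma cexpD z w : cexp (z + w) = cexp z * cexp w.
Proof.
case: z w => [x y] [u v]; rewrite /cexp /= expRD cosD sinD.
by congr Complex; ring.
Qed.

Lemma normc_cexp z : normc (cexp z) = expR (complex.Re z).
Proof.
rewrite /cexp /= !exprMn -mulrDr cos2Dsin2 mulr1 sqrtr_sqr ger0_norm//.
Qed.

Lemma sqrtc_ge0_real (x : R) : 0 <= x -> sqrtc x%:C = (Num.sqrt x)%:C.
Proof. by move=> x0; rewrite sqrtc_sqrtr ?ler0c. Qed.

Lemma sqrtc_le0_real (x : R) : x <= 0 -> sqrtc x%:C = 0 +i* Num.sqrt (- x).
Proof.
move=> x0; rewrite /sqrtc /= expr0n /= addr0 sqrtr_sqr ler0_norm//.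
rewrite eqxx addNr mul0r sqrtr0 mul1r; congr (_ +i* Num.sqrt _).
lra.
Qed.

Definition amplif z : R :=
  let H := normc z ^+ 2 + normc (1 + z ^+ 2) in H + Num.sqrt (H ^+ 2 - 1).

(** With [d ^+ 2 = 1 + y ^+ 2] the eigenvalues are [w ^+ 2] times the squares of [y + d] and
    [y - d]. These two numbers have moduli of product 1, and by the parallelogram law [H] is the
    mean of their squared moduli; hence the larger squared modulus is [H + sqrt (H^2 - 1)]. *)
Lemma max_normc_eig (w y X E : R[i]) : X = 2 * w * y -> E = w ^+ 2 ->
  Num.max (normc (X ^+ 2 / 2 + E + 1 / 2 * sqrtc (X ^+ 2 * (X ^+ 2 + 4 * E))))
          (normc (X ^+ 2 / 2 + E - 1 / 2 * sqrtc (X ^+ 2 * (X ^+ 2 + 4 * E))))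
  = normc w ^+ 2 * amplif y.
Proof.
move=> hX hE.
set Z := X ^+ 2 * (_ + _).
pose d := sqrtc (1 + y ^+ 2).
have d2 : d ^+ 2 = 1 + y ^+ 2 by exact: sqr_sqrtc.
pose B : R[i] := 2 * w ^+ 2 * y * d.
(* Equal squares determine the root up to sign, and the sign only swaps the two eigenvalues, which
   the maximum ignores. *)
have HB : 1 / 2 * sqrtc Z = B \/ 1 / 2 * sqrtc Z = - B.
  have : (1 / 2 * sqrtc Z) ^+ 2 = B ^+ 2 :> R[i].
    rewrite /B !exprMn d2 sqr_sqrtc /Z hX hE; field=> //.
  by move=> /eqP; rewrite (@eqf_sqr (R[i] : fieldType)) => /orP[/eqP|/eqP]; [left|right].
have EA : X ^+ 2 / 2 + E = w ^+ 2 * (y ^+ 2 + d ^+ 2).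
  by rewrite d2 hX hE; field.
have -> : Num.max (normc (X ^+ 2 / 2 + E + 1 / 2 * sqrtc Z))
          (normc (X ^+ 2 / 2 + E - 1 / 2 * sqrtc Z)) =
   Num.max (normc w ^+ 2 * normc (y + d) ^+ 2) (normc w ^+ 2 * normc (y - d) ^+ 2).
  rewrite -!normcX -!normcM.
  have -> : w ^+ 2 * (y + d) ^+ 2 = X ^+ 2 / 2 + E + B by rewrite EA /B; ring.
  have -> : w ^+ 2 * (y - d) ^+ 2 = X ^+ 2 / 2 + E - B by rewrite EA /B; ring.
  by case: HB => ->//; rewrite opprK maxC.
rewrite -maxr_pMr ?sqr_ge0//; congr (_ * _).
rewrite /amplif -d2 normcX.
have P1 := parallelogramc y d.
have P2 : normc (y + d) * normc (y - d) = 1.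
  rewrite -normcM. have -> : (y + d) * (y - d) = -1 by rewrite mulrC -subr_sqr d2; ring.
  by rewrite normcN normc1.
have -> : normc y ^+ 2 + normc d ^+ 2 = (normc (y + d) ^+ 2 + normc (y - d) ^+ 2) / 2.
  by rewrite P1; field.
move: P2 (normc_ge0 (y+d)) (normc_ge0 (y-d)).
move: (normc (y+d)) (normc (y-d)) => p m pm p0 m0.
have -> : ((p ^+ 2 + m ^+ 2) / 2) ^+ 2 - 1 = ((p ^+ 2 - m ^+ 2) / 2) ^+ 2.
  transitivity (((p ^+ 2 + m ^+ 2) / 2) ^+ 2 - (p * m) ^+ 2).
    by rewrite pm expr1n.
  by field.
rewrite sqrtr_sqr.
case: (leP (p ^+ 2) (m ^+ 2)) => h.
  by rewrite ler0_norm; [field|lra].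
by rewrite ger0_norm; [field|lra].
Qed.

End Cexp.

(** * Real inequalities for exponential, hyperbolic and trigonometric functions *)

Section Elementary.
Variable R : realType.
Implicit Types x y u r : R.

Definition sinh x : R := (expR x - expR (- x)) / 2.
Definition cosh x : R := (expR x + expR (- x)) / 2.

Lemma ge0_of_derive_ge0 (f df : R -> R) x : f 0 = 0 ->
  (forall y, is_derive y 1 f (df y)) ->
  (forall y, 0 <= y -> 0 <= df y) -> 0 <= x -> 0 <= f x.
Proof.
move=> f0 dF df0 x0; rewrite -f0.
apply: (@ger0_derive1_ndecry _ f 0) => //.
- move=> y; rewrite in_itv/= andbT => y0.
  by rewrite derive1E (@derive_val _ _ _ _ _ _ _ (dF y)) df0// ltW.
- by apply: derivable_within_continuous => y _; apply: ex_derive; exact: dF.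
Qed.

Lemma cosh_mono x y : 0 <= x -> x <= y -> cosh x <= cosh y.
Proof.
move=> x0 xy; rewrite /cosh ler_pM2r ?invr_gt0// -subr_ge0.
have -> : expR y + expR (- y) - (expR x + expR (- x)) =
    (expR y - expR x) * (1 - expR (- x) * expR (- y)).
  have := expRxMexpNx_1 x; have := expRxMexpNx_1 y.
  move: (expR x) (expR y) (expR (- x)) (expR (- y)) => p q p' q' Hq Hp.
  by ring: Hp Hq.
rewrite mulr_ge0// subr_ge0 ?ler_expR//.
by rewrite -expRD expR_le1; lra.
Qed.

Lemma is_derive_sinhM r x : is_derive x 1 (fun y => sinh (r * y)) (r * cosh (r * x)).
Proof.
rewrite /sinh /cosh.
apply: is_derive_eq.
by rewrite /GRing.scale /=; field.
Qed.

(** The difference vanishes at 0 and has derivative [r (cosh (r y) - cosh y)], nonnegative because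
    [cosh] increases on the half-line. *)
Lemma sinh_ge_scale r x : 1 <= r -> 0 <= x -> r * sinh x <= sinh (r * x).
Proof.
move=> r1 x0; rewrite -subr_ge0.
apply: (@ge0_of_derive_ge0 (fun y => sinh (r * y) - r * sinh y)
  (fun y => r * cosh (r * y) - r * cosh y)) x0.
- by rewrite /sinh mulr0 oppr0 subrr mul0r mulr0 subrr.
- move=> y. have := is_derive_sinhM r y. have := is_derive_sinhM 1 y.
  rewrite !mul1r => d1 d2.
  have d1' : is_derive y 1 sinh (cosh y).
    by move: d1; under eq_fun do rewrite mul1r.
  apply: is_derive_eq.
  by rewrite /GRing.scale /=; ring.
- move=> y y0; rewrite -mulrBr mulr_ge0//; first lra.
  rewrite subr_ge0 cosh_mono//. by rewrite ler_peMl.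
Qed.

Lemma sinh_ge_id x : 0 <= x -> x <= sinh x.
Proof.
move=> x0; rewrite -subr_ge0.
apply: (@ge0_of_derive_ge0 (fun y => sinh y - y) (fun y => cosh y - 1)) x0.
- by rewrite /sinh oppr0 subrr mul0r addr0.
- move=> y; have := is_derive_sinhM 1 y; rewrite !mul1r.
  under eq_fun do rewrite mul1r.
  by move=> d1; apply: is_derive_eq.
- move=> y y0; rewrite subr_ge0.
  have <- : cosh 0 = 1 :> R by rewrite /cosh oppr0 expR0; field.
  exact: cosh_mono.
Qed.

Lemma sinh_ge0 x : 0 <= x -> 0 <= sinh x.
Proof. by move=> x0; exact: le_trans x0 (sinh_ge_id x0). Qed.

(** From [exp x (1 - x) <= 1], since [(1 - x)(1 + x + 2 x^2) = 1 + x^2 (1 - 2 x)] is at least 1 for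
    [x <= 1 / 2]. *)
Lemma expR_le_quadratic x : x <= 1 / 2 -> expR x <= 1 + x + 2 * x ^+ 2.
Proof.
move=> x2; have h := expR_ge1Dx (- x).
have e := expRxMexpNx_1 x; have := expR_gt0 x.
by nra.
Qed.

Lemma sin_le_id x : 0 <= x -> sin x <= x.
Proof.
move=> x0; rewrite -subr_ge0.
apply: (@ge0_of_derive_ge0 (fun y => y - sin y) (fun y => 1 - cos y)) x0.
- by rewrite sin0 subrr.
- by move=> y _; rewrite subr_ge0 cos_le1.
Qed.

Lemma cos_ge_lin x : 0 <= x -> 1 - x <= cos x.
Proof.
move=> x0; rewrite -subr_ge0.
apply: (@ge0_of_derive_ge0 (fun y => cos y - (1 - y)) (fun y => 1 - sin y)) x0.
- by rewrite cos0 subr0 subrr.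
- by move=> y /=; apply: is_derive_eq; ring.
- by move=> y _; rewrite subr_ge0 sin_le1.
Qed.

Lemma sin_ge_quadratic x : 0 <= x -> x - x ^+ 2 / 2 <= sin x.
Proof.
move=> x0; rewrite -subr_ge0.
apply: (@ge0_of_derive_ge0 (fun y => sin y - (y - y ^+ 2 / 2))
  (fun y => cos y - (1 - y))) x0.
- by rewrite sin0; field.
- by move=> y /=; apply: is_derive_eq; rewrite /GRing.scale /=; field.
- by move=> y y0; rewrite subr_ge0 cos_ge_lin.
Qed.

(** First-order Taylor estimate for the real part of the complex [sinh (x + i y)], with the error
    measured by a common bound [t]; the next lemma treats the imaginary part. *)
Lemma sinh_cos_approx t x y : 0 <= x <= t -> 0 <= y <= t -> t <= 1 / 2 ->
  `|sinh x * cos y - x| <= t ^+ 2.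
Proof.
move=> /andP[x0 xt] /andP[y0 yt] t2.
have c1 := cos_le1 y; have c2 := cos_ge_lin y0.
have s1 := sinh_ge_id x0.
have s2 : sinh x <= x + x ^+ 2.
  have : expR x <= 1 + x + 2 * x ^+ 2 by apply: expR_le_quadratic; lra.
  have := expR_ge1Dx (- x).
  by rewrite /sinh; lra.
have xxt : x ^+ 2 <= t ^+ 2 by nra.
have xyt : x * y <= t ^+ 2 by nra.
rewrite ler_norml; apply/andP; split; nra.
Qed.

Lemma cosh_sin_approx t x y : 0 <= x <= t -> 0 <= y <= t -> t <= 1 / 2 ->
  `|cosh x * sin y - y| <= t ^+ 2.
Proof.
move=> /andP[x0 xt] /andP[y0 yt] t2.
have c1 := sin_le_id y0; have c2 := sin_ge_quadratic y0.
have h1 : 1 <= cosh x.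
  have <- : cosh 0 = 1 :> R by rewrite /cosh oppr0 expR0; field.
  exact: cosh_mono.
have h2 : cosh x <= 1 + x.
  have : expR x <= 1 + x + 2 * x ^+ 2 by apply: expR_le_quadratic; lra.
  have : expR (- x) <= 1 by rewrite expR_le1; lra.
  by rewrite /cosh; nra.
have yyt : y ^+ 2 <= t ^+ 2 by nra.
have xyt : x * y <= t ^+ 2 by nra.
have s0 : 0 <= sin y by nra.
rewrite ler_norml; apply/andP; split; nra.
Qed.

End Elementary.

(** * Bounds for the amplification in elliptic coordinates *)

Section Amplif.
Variable R : realType.
Local Open Scope complex_scope.
Implicit Types al be u : R.

Lemma amplifE al be : amplif (al +i* be) =
  let H := al ^+ 2 + be ^+ 2 +
    Num.sqrt ((1 + al ^+ 2 - be ^+ 2) ^+ 2 + 4 * al ^+ 2 * be ^+ 2) in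
  H + Num.sqrt (H ^+ 2 - 1).
Proof.
rewrite /amplif normc_sqr /=.
have -> : (1 + (al * al - be * be)) ^+ 2 + (0 + (al * be + be * al)) ^+ 2 =
  (1 + al ^+ 2 - be ^+ 2) ^+ 2 + 4 * al ^+ 2 * be ^+ 2 by ring.
by [].
Qed.

(** Bounding [|1 + z^2|] below by its real part gives [H >= 1 + 2 al^2], hence
    [H^2 - 1 >= 4 al^2]. *)
Lemma amplif_ge al be : 1 + 2 * `|al| <= amplif (al +i* be).
Proof.
rewrite amplifE /=.
set s := Num.sqrt (_ + _).
have hs : 1 + al ^+ 2 - be ^+ 2 <= s.
  apply: le_trans (ler_norm _) _; rewrite -sqrtr_sqr ler_wsqrtr// lerDl.
  by apply: mulr_ge0; [apply: mulr_ge0|]; rewrite ?sqr_ge0.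
have hH : 1 + 2 * al ^+ 2 <= al ^+ 2 + be ^+ 2 + s by lra.
have al0 := sqr_ge0 al.
rewrite lerD//; first lra.
have -> : 2 * `|al| = Num.sqrt (4 * al ^+ 2).
  have -> : 4 * al ^+ 2 = (2 * al) ^+ 2 by ring.
  by rewrite sqrtr_sqr normrM ger0_norm.
by rewrite ler_wsqrtr//; nra.
Qed.

(** At [z = sinh (u + i v)] one has [H = cosh (2 u)] and amplification [exp (2 u)], so the level
    curves are the confocal ellipses [al^2 / sinh^2 u + be^2 / cosh^2 u = 1]. The hypothesis has
    [be^2] in place of [be^2 / cosh^2 u] and so describes a smaller ellipse. *)
Lemma amplif_le al be u : 0 <= u -> be ^+ 2 <= 1 ->
  al ^+ 2 <= (1 - be ^+ 2) * sinh u ^+ 2 -> amplif (al +i* be) <= expR (2 * u).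
Proof.
move=> u0 b1 hal; rewrite amplifE /=.
set s := Num.sqrt (_ + _).
have al0 := sqr_ge0 al; have be0 := sqr_ge0 be; have S0 := sqr_ge0 (sinh u).
have hs : s <= 1 + 2 * sinh u ^+ 2 - al ^+ 2 - be ^+ 2.
  have hS : al ^+ 2 <= sinh u ^+ 2 by nra.
  have e : 0 <= 1 + 2 * sinh u ^+ 2 - al ^+ 2 - be ^+ 2 by lra.
  rewrite -(ger0_norm e) -sqrtr_sqr ler_wsqrtr//.
  (* The difference of the two squares is [4 ((1 - B) S - A + S (S - A))], where [A], [B], [S] stand
     for the squares of [al], [be], [sinh u]. *)
  move: hal hS al0 be0 S0 b1; rewrite -/s.
  move: (al ^+ 2) (be ^+ 2) (sinh u ^+ 2) => A B S *; nra.
have s0 : 0 <= s := sqrtr_ge0 _.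
set H := _ + s.
have hH : H <= 1 + 2 * sinh u ^+ 2 by rewrite /H; lra.
have H0 : 0 <= H by rewrite /H; lra.
have uu : expR (2 * u) = expR u ^+ 2 by rewrite -expRM_natl.
have ch : 0 <= sinh u * cosh u.
  by rewrite mulr_ge0 ?sinh_ge0// /cosh divr_ge0// addr_ge0// expR_ge0.
have cs : cosh u ^+ 2 = 1 + sinh u ^+ 2.
  have := expRxMexpNx_1 u; rewrite /cosh /sinh.
  move: (expR u) (expR (- u)) => p q pq.
  have -> : ((p + q) / 2) ^+ 2 = p * q + ((p - q) / 2) ^+ 2 by field.
  by rewrite pq.
have hsq : Num.sqrt (H ^+ 2 - 1) <= 2 * (sinh u * cosh u).
  have c0 : 0 <= 2 * (sinh u * cosh u) by rewrite mulr_ge0.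
  rewrite -(ger0_norm c0) -sqrtr_sqr ler_wsqrtr//.
  have -> : (2 * (sinh u * cosh u)) ^+ 2 = 4 * (sinh u ^+ 2 * cosh u ^+ 2) by ring.
  rewrite cs.
  move: H0 hH S0; move: (sinh u ^+ 2) => S *; nra.
have <- : 1 + 2 * sinh u ^+ 2 + 2 * (sinh u * cosh u) = expR (2 * u).
  rewrite uu; have -> : expR u = sinh u + cosh u by rewrite /sinh /cosh; field.
  transitivity (cosh u ^+ 2 + sinh u ^+ 2 + 2 * (sinh u * cosh u)).
    by rewrite cs; ring.
  by ring.
exact: lerD.
Qed.

End Amplif.

(** * The convergence factor as decay times amplification *)

Section RhoFormula.
Variable R : realType.
Local Open Scope complex_scope.
Implicit Types (z w : R[i]) (k omega Cp Cs delta h : R).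

Definition csinh z : R[i] :=
  (sinh (complex.Re z) * cos (complex.Im z))
  +i* (cosh (complex.Re z) * sin (complex.Im z)).

Lemma cexp_subN z : cexp z - cexp (- z) = 2 * csinh z.
Proof.
case: z => x y; rewrite mulr_natl mulr2n /cexp /csinh /sinh /cosh /= cosN sinN.
by congr Complex; field.
Qed.

(** Taking [w] out of [exp (- l1 delta) - exp (- l2 delta)] leaves [2 csinh ((l2 - l1) delta / 2)];
    the real exponential is [|w|^2]. *)
Lemma rho_claE k omega Cp Cs delta :
  let l1 := lambda1 k omega Cs in
  let l2 := lambda2 k omega Cp in
  let h := (delta / 2)%:C in
  let q := (k%:C ^+ 2 + l1 * l2) / (k%:C ^+ 2 - l1 * l2) in
  rho_cla k omega Cp Cs delta =
  expR (- (delta * (complex.Re l1 + complex.Re l2)))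
  * amplif (q * csinh ((l2 - l1) * h)).
Proof.
move=> l1 l2 h q.
pose w : R[i] := cexp (- ((l1 + l2) * h)).
have hh : delta%:C = h + h by rewrite -rmorphD /= -splitr.
have -> : expR (- (delta * (complex.Re l1 + complex.Re l2))) = normc w ^+ 2.
  rewrite normc_cexp -expRM_natl; congr expR.
  case: (l1) (l2) => [x1 y1] [x2 y2] /=; field=> //.
rewrite /rho_cla /r_plus /r_minus; apply: max_normc_eig.
  transitivity (q * (w * (2 * csinh ((l2 - l1) * h)))); last by ring.
  rewrite -cexp_subN mulrBr -!cexpD /schwarz_X; congr (_ * (cexp _ - cexp _));
  by rewrite hh -/l1 -/l2; ring.
by rewrite expr2 -cexpD /schwarz_E; congr cexp; rewrite hh -/l1 -/l2; ring.
Qed.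

End RhoFormula.

(** * Frequencies below both or above both cutoffs *)

Section Regimes.
Variables (R : realType) (omega Cp Cs : R).
Hypotheses (omega_gt0 : 0 < omega) (Cs_gt0 : 0 < Cs) (Cs_lt_Cp : Cs < Cp).
Local Open Scope complex_scope.
Implicit Types k delta : R.

Let a : R := omega ^+ 2 / Cs ^+ 2.
Let b : R := omega ^+ 2 / Cp ^+ 2.

Lemma pressure_cutoff_gt0 : 0 < b.
Proof. by rewrite /b divr_gt0// exprn_gt0// (lt_trans Cs_gt0). Qed.

Lemma pressure_cutoff_lt_shear_cutoff : b < a.
Proof.
rewrite /a /b ltr_pM2l ?exprn_gt0// ltf_pV2 ?posrE ?exprn_gt0//.
  by rewrite ltr_pXn2r// nnegrE ltW// (lt_trans Cs_gt0).
exact: lt_trans Cs_lt_Cp.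
Qed.

Lemma lambda1_imag k : k ^+ 2 <= a ->
  lambda1 k omega Cs = 0 +i* Num.sqrt (a - k ^+ 2).
Proof. by move=> ka; rewrite /lambda1 sqrtc_le0_real ?opprB// subr_le0. Qed.

Lemma lambda1_real k : a <= k ^+ 2 ->
  lambda1 k omega Cs = (Num.sqrt (k ^+ 2 - a))%:C.
Proof. by move=> ka; rewrite /lambda1 sqrtc_ge0_real// subr_ge0. Qed.

Lemma lambda2_imag k : k ^+ 2 <= b ->
  lambda2 k omega Cp = 0 +i* Num.sqrt (b - k ^+ 2).
Proof. by move=> ka; rewrite /lambda2 sqrtc_le0_real ?opprB// subr_le0. Qed.

Lemma lambda2_real k : b <= k ^+ 2 ->
  lambda2 k omega Cp = (Num.sqrt (k ^+ 2 - b))%:C.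
Proof. by move=> ka; rewrite /lambda2 sqrtc_ge0_real// subr_ge0. Qed.

(* both waves propagate *)
Lemma rho_cla_low k delta : k ^+ 2 <= b -> rho_cla k omega Cp Cs delta <= 1.
Proof.
move=> kb; have ab := pressure_cutoff_lt_shear_cutoff; have b0 := pressure_cutoff_gt0.
rewrite rho_claE; cbv zeta; rewrite lambda1_imag ?lambda2_imag//; last lra.
set s1 := Num.sqrt _; set s2 := Num.sqrt _.
have s10 : 0 <= s1 := sqrtr_ge0 _. have s20 : 0 <= s2 := sqrtr_ge0 _.
rewrite [X in expR X](_ : _ = 0) ?expR0 ?mul1r; last first.
  by rewrite /= addr0 mulr0 oppr0.
pose q := (k ^+ 2 - s1 * s2) / (k ^+ 2 + s1 * s2).
have qN : `|q| <= 1.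
  have k0 := sqr_ge0 k; have p0 : 0 <= s1 * s2 by rewrite mulr_ge0.
  have d0 : 0 <= k ^+ 2 + s1 * s2 by lra.
  (* Inversion sends 0 to 0, so the bound also holds for a vanishing denominator. *)
  have [e|d1] := eqVneq (k ^+ 2 + s1 * s2) 0.
    by rewrite /q e invr0 mulr0 normr0.
  rewrite /q normrM normfV (ger0_norm d0) ler_pdivrMr ?lt0r ?d1// mul1r.
  by rewrite ler_norml; apply/andP; split; lra.
have e1 : k%:C ^+ 2 + (0 +i* s1) * (0 +i* s2) = (k ^+ 2 - s1 * s2)%:C.
  by apply/eqP; rewrite eq_complex /=; apply/andP; split; apply/eqP; ring.
have e2 : k%:C ^+ 2 - (0 +i* s1) * (0 +i* s2) = (k ^+ 2 + s1 * s2)%:C.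
  by apply/eqP; rewrite eq_complex /=; apply/andP; split; apply/eqP; ring.
have e3 : csinh ((0 +i* s2 - 0 +i* s1) * (delta / 2)%:C) =
    0 +i* sin ((s2 - s1) * (delta / 2)).
  have -> : (0 +i* s2 - 0 +i* s1) * (delta / 2)%:C = 0 +i* ((s2 - s1) * (delta / 2)).
    by apply/eqP; rewrite eq_complex /=; apply/andP; split; apply/eqP; ring.
  by rewrite /csinh /= /sinh /cosh oppr0 expR0 subrr !mul0r; congr Complex; field.
rewrite e1 e2 e3 -fmorphV -rmorphM /= -/q.
have -> : q%:C * (0 +i* sin ((s2 - s1) * (delta / 2))) =
    0 +i* (q * sin ((s2 - s1) * (delta / 2))).
  by apply/eqP; rewrite eq_complex /=; apply/andP; split; apply/eqP; ring.
(* For [u = 0] the ellipse degenerates to the segment from [-i] to [i]. *)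
have h : amplif (0 +i* (q * sin ((s2 - s1) * (delta / 2)))) <= expR (2 * 0).
  apply: amplif_le => //.
    have := mulr_ile1 (normr_ge0 q) (normr_ge0 _) qN
      (sin_max ((s2 - s1) * (delta / 2))).
    by rewrite -normrM ler_norml => /andP[]; nra.
  by rewrite /sinh oppr0 subrr mul0r expr0n mulr0.
by rewrite mulr0 expR0 in h.
Qed.

(* both waves are evanescent *)
Lemma rho_cla_high k delta : 0 < delta -> a <= k ^+ 2 ->
  rho_cla k omega Cp Cs delta <= 1.
Proof.
move=> d0 ak; have ab := pressure_cutoff_lt_shear_cutoff; have b0 := pressure_cutoff_gt0.
rewrite rho_claE; cbv zeta; rewrite lambda1_real ?lambda2_real//; last lra.
set s1 := Num.sqrt _; set s2 := Num.sqrt _.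
have s10 : 0 <= s1 := sqrtr_ge0 _. have s20 : 0 <= s2 := sqrtr_ge0 _.
have s1E : s1 ^+ 2 = k ^+ 2 - a by rewrite sqr_sqrtr; lra.
have s2E : s2 ^+ 2 = k ^+ 2 - b by rewrite sqr_sqrtr; lra.
have s12 : s1 < s2 by rewrite /s1 /s2 ltr_sqrt; lra.
have pK : s1 * s2 < k ^+ 2 by nra.
pose q := (k ^+ 2 + s1 * s2) / (k ^+ 2 - s1 * s2).
(* [r] is the ratio of the decay exponent [u] to the argument [v] of [sinh]. Then
   [q sinh v <= r sinh v <= sinh u], and the amplification [exp (2 u)] cancels the decay. *)
pose r := (s1 + s2) / (s2 - s1).
have r1 : 1 <= r by rewrite /r ler_pdivlMr; lra.
have q0 : 0 <= q by rewrite /q divr_ge0//; nra.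
(* After cross-multiplication the two sides differ by [2 s1 (k^2 - s2^2) = 2 s1 b]. *)
have qr : q <= r.
  rewrite /q /r ler_pdivrMr; last lra.
  rewrite mulrAC ler_pdivlMr; last lra.
  have : 0 <= s1 * b by rewrite mulr_ge0// ltW.
  by nra.
have e1 : k%:C ^+ 2 + s1%:C * s2%:C = (k ^+ 2 + s1 * s2)%:C.
  by rewrite -rmorphXn -rmorphM -rmorphD.
have e2 : k%:C ^+ 2 - s1%:C * s2%:C = (k ^+ 2 - s1 * s2)%:C.
  by rewrite -rmorphXn -rmorphM -rmorphB.
have e3 : csinh ((s2%:C - s1%:C) * (delta / 2)%:C) =
    (sinh ((s2 - s1) * (delta / 2)))%:C.
  rewrite -rmorphB -rmorphM /csinh /= sin0 cos0 mulr1 mulr0 //.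
rewrite e1 e2 e3 -fmorphV -!rmorphM /= -/q.
set v := (s2 - s1) * _.
have v0 : 0 <= v by rewrite /v mulr_ge0; lra.
pose u := (s1 + s2) * (delta / 2).
have uE : u = r * v.
  by rewrite /u /v /r mulrA divfK//; apply/eqP; lra.
have -> : delta * (s1 + s2) = 2 * u by rewrite /u; field.
rewrite expRN mulrC ler_pdivrMr ?expR_gt0// mul1r.
have u0 : 0 <= u by rewrite uE mulr_ge0//; lra.
apply: amplif_le => //; first by rewrite expr0n.
rewrite expr0n subr0 mul1r.
apply: lerXn2r; rewrite ?nnegrE ?sinh_ge0//.
  by apply: mulr_ge0; rewrite ?sinh_ge0.
rewrite uE; apply: le_trans (sinh_ge_scale r1 v0).
by rewrite ler_wpM2r// sinh_ge0.
Qed.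

End Regimes.

(** * First-order expansion of the damped amplification *)

Section AmplifApprox.
Variables (R : realType).
Local Open Scope complex_scope.
Implicit Types A B x y t : R.

(** The argument of [amplif] is [(A + i B)] times the conjugate of [sinh (x + i y)]. Its imaginary
    part is of order [t] and enters only at second order, so the amplification is [1 + 2 |al|] up to
    [O(t^2)]. The last hypothesis keeps [al0] nonnegative, so that [|al|] can be replaced by
    [al0]. *)
Lemma amplif_approx A B x y t : A ^+ 2 + B ^+ 2 = 1 ->
  0 <= x <= t -> 0 <= y <= t -> t <= 1 / 16 -> x <= A * x + B * y ->
  `|expR (- (2 * x)) * amplif
     ((A * (sinh x * cos y) + B * (cosh x * sin y))
       +i* (B * (sinh x * cos y) - A * (cosh x * sin y)))
    - (1 + 2 * (A * x + B * y - x))| <= 54 * t ^+ 2.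
Proof.
move=> AB xt yt t16.
set al0 := A * x + B * y => xal.
have t2 : t <= 1 / 2 by lra.
have hP := sinh_cos_approx xt yt t2; have hQ := cosh_sin_approx xt yt t2.
move: hP hQ; set P := sinh x * cos y; set Q := cosh x * sin y => hP hQ.
move: xt yt => /andP[x0 xt] /andP[y0 yt].
have t0 : 0 <= t by lra.
have A2 := sqr_ge0 A; have B2 := sqr_ge0 B.
have A1 : -1 <= A <= 1 by apply/andP; split; nra.
have B1 : -1 <= B <= 1 by apply/andP; split; nra.
have An : `|A| <= 1 by rewrite ler_norml.
have Bn : `|B| <= 1 by rewrite ler_norml.
set al := A * P + B * Q; set be := B * P - A * Q.
have tt : t ^+ 2 <= t / 16 by nra.
have tt0 : 0 <= t ^+ 2 := sqr_ge0 t.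
have alE : `|al - al0| <= 2 * t ^+ 2.
  have -> : al - al0 = A * (P - x) + B * (Q - y) by rewrite /al /al0; ring.
  apply: le_trans (ler_normD _ _) _; rewrite !normrM.
  have -> : 2 * t ^+ 2 = 1 * t ^+ 2 + 1 * t ^+ 2 by ring.
  by apply: lerD; apply: ler_pM.
have al0t : al0 <= 2 * t.
  move: A1 B1 => /andP[_ A1] /andP[_ B1]; rewrite /al0; nra.
have N : al ^+ 2 + be ^+ 2 = P ^+ 2 + Q ^+ 2.
  transitivity ((A ^+ 2 + B ^+ 2) * (P ^+ 2 + Q ^+ 2)); last by rewrite AB mul1r.
  by rewrite /al /be; ring.
move: hP hQ alE; rewrite !ler_norml => /andP[P1 P2] /andP[Q1 Q2] /andP[al1 al2].
have al20 := sqr_ge0 al; have be20 := sqr_ge0 be.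
have PP : P ^+ 2 <= 2 * t ^+ 2 by nra.
have QQ : Q ^+ 2 <= 2 * t ^+ 2 by nra.
have be2 : be ^+ 2 <= 4 * t ^+ 2 by lra.
have gt : 2 * (al0 - x) <= 4 * t by lra.
set g := 2 * (al0 - x) in gt *.
have g0 : 0 <= g by rewrite /g; lra.
clear P1 P2 Q1 Q2 PP QQ A2 B2 A1 B1 An Bn N.
apply/andP; split.
- have h := amplif_ge al be.
  have e := expR_ge1Dx (- (2 * x)).
  have e0 := expR_ge0 (- (2 * x)).
  have aal := ler_norm al.
  have h2 : 1 + 2 * (al0 - 2 * t ^+ 2) <= amplif (al +i* be) by lra.
  have h3 : 0 <= 1 + 2 * (al0 - 2 * t ^+ 2) by lra.
  have h4 : (1 - 2 * x) * (1 + 2 * (al0 - 2 * t ^+ 2))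
      <= expR (- (2 * x)) * amplif (al +i* be).
    apply: le_trans (_ : expR (- (2 * x)) * (1 + 2 * (al0 - 2 * t ^+ 2)) <= _).
      by apply: ler_wpM2r => //; lra.
    exact: ler_wpM2l.
  have xa : x * al0 <= 2 * t ^+ 2 by nra.
  have xtt : 0 <= x * t ^+ 2 by rewrite mulr_ge0.
  rewrite /g; nra.
(* The margin [5 t^2] covers the error [2 t^2] of [al] and the factor [1 + 2 be^2 <= 1 + 8 t^2]
   below. *)
- pose u := al0 + 5 * t ^+ 2.
  have al0p : 0 <= al0 by lra.
  have u0 : 0 <= u by rewrite /u; lra.
  have b1 : be ^+ 2 <= 1 by nra.
  have key : al ^+ 2 <= (1 - be ^+ 2) * u ^+ 2.
    (* as [sinh u >= u], it suffices that [|al| / sqrt (1 - be^2) <= u] *)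
    have k1 : `|al| * (1 + 2 * be ^+ 2) <= u.
      apply: le_trans (_ : (al0 + 2 * t ^+ 2) * (1 + 8 * t ^+ 2) <= _).
        apply: ler_pM => //; [lra| |lra].
        by rewrite ler_norml; apply/andP; split; lra.
      rewrite /u; nra.
    have k2 : al ^+ 2 * (1 + 2 * be ^+ 2) ^+ 2 <= u ^+ 2.
      rewrite -(real_normK (num_real al)) -exprMn lerXn2r ?nnegrE//.
      by rewrite mulr_ge0//; lra.
    (* For small [z = be^2], [1 + 2 z] dominates [1 / sqrt (1 - z)]. *)
    have k3 : 1 <= (1 - be ^+ 2) * (1 + 2 * be ^+ 2) ^+ 2.
      move: be2 be20; move: (be ^+ 2) => z *; nra.
    apply: le_trans (_ : al ^+ 2 * ((1 - be ^+ 2) * (1 + 2 * be ^+ 2) ^+ 2) <= _).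
      by rewrite ler_peMr.
    rewrite mulrCA ler_wpM2l//; lra.
  have h : amplif (al +i* be) <= expR (2 * u).
    apply: amplif_le => //; apply: le_trans key _.
    rewrite ler_wpM2l//; first lra.
    by rewrite lerXn2r ?nnegrE ?sinh_ge0 ?sinh_ge_id.
  have h2 : expR (- (2 * x)) * amplif (al +i* be) <= expR (g + 10 * t ^+ 2).
    have -> : g + 10 * t ^+ 2 = - (2 * x) + 2 * u by rewrite /g /u; ring.
    by rewrite expRD ler_wpM2l// expR_ge0.
  have h3 : expR (g + 10 * t ^+ 2) <= 1 + (g + 10 * t ^+ 2) + 2 * (g + 10 * t ^+ 2) ^+ 2.
    by apply: expR_le_quadratic; lra.
  (* This yields the constant of the statement: [10 + 2 * 22 = 54]. *)
  have h4 : (g + 10 * t ^+ 2) ^+ 2 <= 22 * t ^+ 2.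
    have : g + 10 * t ^+ 2 <= 37 / 8 * t by lra.
    have : 0 <= g + 10 * t ^+ 2 by lra.
    move: (g + _) => z *; nra.
  lra.
Qed.

End AmplifApprox.

(** * Frequencies between the cutoffs: expansion and existence of the maximum *)

Section IntermediateRegime.
Variables (R : realType) (omega Cp Cs : R).
Hypotheses (omega_gt0 : 0 < omega) (Cs_gt0 : 0 < Cs) (Cs_lt_Cp : Cs < Cp).
Local Open Scope complex_scope.
Implicit Types k delta : R.

Let a : R := omega ^+ 2 / Cs ^+ 2.
Let b : R := omega ^+ 2 / Cp ^+ 2.

Let b0 : 0 < b := pressure_cutoff_gt0 omega_gt0 Cs_gt0 Cs_lt_Cp.
Let ab : b < a := pressure_cutoff_lt_shear_cutoff omega_gt0 Cs_gt0 Cs_lt_Cp.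

(** Here [lambda1 = i xi] and [lambda2 = eta]; [D] is the squared modulus of
    [k^2 - lambda1 lambda2], [A + i B] is the unimodular quotient [q], and [P - i Q] is the [csinh]
    factor. *)
Let xi k : R := Num.sqrt (a - k ^+ 2).
Let eta k : R := Num.sqrt (k ^+ 2 - b).
Let D k : R := k ^+ 4 + xi k ^+ 2 * eta k ^+ 2.
Let A k : R := (k ^+ 4 - xi k ^+ 2 * eta k ^+ 2) / D k.
Let B k : R := 2 * k ^+ 2 * xi k * eta k / D k.
Let P k delta : R := sinh (eta k * (delta / 2)) * cos (xi k * (delta / 2)).
Let Q k delta : R := cosh (eta k * (delta / 2)) * sin (xi k * (delta / 2)).

Lemma denom_gt0 k : b <= k ^+ 2 -> 0 < D k.
Proof.
move=> bk; rewrite /D ltr_wpDr//; first by rewrite mulr_ge0// sqr_ge0.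
have -> : k ^+ 4 = (k ^+ 2) ^+ 2 by ring.
by apply: exprn_gt0; exact: lt_le_trans b0 bk.
Qed.

Lemma rho_cla_mid k delta : b <= k ^+ 2 -> k ^+ 2 <= a ->
  rho_cla k omega Cp Cs delta = expR (- (delta * eta k)) *
    amplif ((A k * P k delta + B k * Q k delta)
       +i* (B k * P k delta - A k * Q k delta)).
Proof.
move=> bk ka.
rewrite rho_claE; cbv zeta; rewrite lambda1_imag ?lambda2_real//.
rewrite -/(xi k) -/(eta k).
have -> : complex.Re (0 +i* xi k) + complex.Re (eta k)%:C = eta k by rewrite /= add0r.
congr (_ * amplif _).
have d0 := denom_gt0 bk.
have nz : k%:C ^+ 2 - (0 +i* xi k) * (eta k)%:C != 0.
  rewrite eq_complex /= negb_and; apply/orP; left.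
  rewrite !mul0r !mulr0 subr0 subr0 subr0 -expr2; apply/eqP => h.
  by move: bk; rewrite h leNgt b0.
have -> : (k%:C ^+ 2 + (0 +i* xi k) * (eta k)%:C)
    / (k%:C ^+ 2 - (0 +i* xi k) * (eta k)%:C) = A k +i* B k.
  apply: (canLR (mulfK nz)); apply/eqP; rewrite eq_complex /=.
  rewrite /A /B; apply/andP; split; apply/eqP; move: d0; rewrite /D => d0; field;
  by apply/eqP; lra.
have -> : csinh (((eta k)%:C - (0 +i* xi k)) * (delta / 2)%:C)
    = P k delta +i* - Q k delta.
  have -> : ((eta k)%:C - (0 +i* xi k)) * (delta / 2)%:C =
      (eta k * (delta / 2)) +i* - (xi k * (delta / 2)).
    by apply/eqP; rewrite eq_complex /=; apply/andP; split; apply/eqP; ring.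
  by rewrite /csinh /= cosN sinN mulrN.
by apply/eqP; rewrite eq_complex /=; apply/andP; split; apply/eqP; ring.
Qed.

(** This is [A eta + B xi - eta], simplified by [k^2 - eta^2 = b]: the coefficient of [delta] in the
    convergence factor. *)
Definition growth k : R :=
  2 * b * eta k * xi k ^+ 2 / D k.

(** Both [xi] and [eta] are at most [sqrt a], so [t = sqrt a delta] serves for every [k] and the
    error is uniform. Nonnegativity of [growth] supplies the sign condition. *)
Lemma rho_cla_mid_approx k delta : b <= k ^+ 2 -> k ^+ 2 <= a ->
  0 < delta -> Num.sqrt a * delta <= 1 / 16 ->
  `|rho_cla k omega Cp Cs delta - (1 + growth k * delta)| <= 54 * a * delta ^+ 2.
Proof.
move=> bk ka d0 ad; have D0 := denom_gt0 bk.
have xi0 : 0 <= xi k := sqrtr_ge0 _. have eta0 : 0 <= eta k := sqrtr_ge0 _.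
have xiE : xi k ^+ 2 = a - k ^+ 2 by rewrite sqr_sqrtr ?subr_ge0.
have etaE : eta k ^+ 2 = k ^+ 2 - b by rewrite sqr_sqrtr ?subr_ge0.
have xia : xi k <= Num.sqrt a by rewrite ler_wsqrtr// gerBl sqr_ge0.
have etaa : eta k <= Num.sqrt a.
  by rewrite ler_wsqrtr// (le_trans _ ka)// gerBl ltW.
have aE : Num.sqrt a ^+ 2 = a by rewrite sqr_sqrtr// ltW// (lt_trans b0).
have e : A k * (eta k * (delta / 2)) + B k * (xi k * (delta / 2)) - eta k * (delta / 2)
    = growth k * delta / 2.
  rewrite /A /B /growth; move: D0; rewrite /D => D0.
  have -> : b = k ^+ 2 - eta k ^+ 2 by rewrite etaE; ring.
  field; by apply/eqP; lra.
rewrite rho_cla_mid//.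
have -> : delta * eta k = 2 * (eta k * (delta / 2)) by field.
have -> : growth k * delta = 2 * (growth k * delta / 2) by field.
rewrite -e.
have -> : 54 * a * delta ^+ 2 = 54 * (Num.sqrt a * delta) ^+ 2 by rewrite exprMn aE; ring.
apply: amplif_approx => //.
- rewrite /A /B; move: D0; rewrite /D => D0; field; by apply/eqP; lra.
- by apply/andP; split; nra.
- by apply/andP; split; nra.
- rewrite -subr_ge0 e /growth.
  by rewrite !mulr_ge0 ?invr_ge0 ?sqr_ge0// ltW.
Qed.

(** The convergence factor as a composition of real continuous functions. *)
Let F delta k : R :=
  let al := A k * P k delta + B k * Q k delta in
  let be := B k * P k delta - A k * Q k delta in
  let H := al ^+ 2 + be ^+ 2 +
    Num.sqrt ((1 + al ^+ 2 - be ^+ 2) ^+ 2 + 4 * al ^+ 2 * be ^+ 2) in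
  expR (- (delta * eta k)) * (H + Num.sqrt (H ^+ 2 - 1)).

Lemma F_continuous delta k : b <= k ^+ 2 -> {for k, continuous (F delta)}.
Proof.
move=> bk.
have pow_c (f : R -> R) (l : R) n : f @ k --> l ->
    (fun x => f x ^+ n) @ k --> l ^+ n.
  by move=> h; exact: (@cvg_comp _ _ _ f (fun x : R => x ^+ n) _ _ _ h
    (@exprn_continuous R n l)).
have sqrt_c (f : R -> R) : f @ k --> f k ->
    (fun x => Num.sqrt (f x)) @ k --> Num.sqrt (f k).
  by move=> h; apply: (cvg_comp _ _ h); exact: sqrt_continuous.
have exp_c (f : R -> R) : f @ k --> f k ->
    (fun x => expR (f x)) @ k --> expR (f k).
  by move=> h; apply: (cvg_comp _ _ h); exact: continuous_expR.
have xi_c : xi @ k --> xi k.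
  apply: (sqrt_c); apply: cvgB; first exact: cvg_cst. by apply: (pow_c).
have eta_c : eta @ k --> eta k.
  apply: (sqrt_c); apply: cvgB; last exact: cvg_cst. by apply: (pow_c).
have D_c : D @ k --> D k.
  by apply: cvgD; [exact: pow_c|apply: cvgM; exact: pow_c].
have D0 : D k != 0 by rewrite gt_eqF// denom_gt0.
have A_c : A @ k --> A k.
  apply: cvgM; last exact: cvgV.
  by apply: cvgB; [exact: pow_c|apply: cvgM; exact: pow_c].
have B_c : B @ k --> B k.
  apply: cvgM; last exact: cvgV.
  apply: cvgM => //; apply: cvgM => //; apply: cvgM; [exact: cvg_cst|exact: pow_c].
have xid : (fun x => xi x * (delta / 2)) @ k --> xi k * (delta / 2).
  by apply: cvgM => //; exact: cvg_cst.
have etad : (fun x => eta x * (delta / 2)) @ k --> eta k * (delta / 2).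
  by apply: cvgM => //; exact: cvg_cst.
have P_c : P ^~ delta @ k --> P k delta.
  apply: cvgM; last by apply: (cvg_comp _ _ xid); exact: continuous_cos.
  apply: cvgM; last exact: cvg_cst.
  by apply: cvgB; apply: (exp_c) => //; exact: cvgN.
have Q_c : Q ^~ delta @ k --> Q k delta.
  apply: cvgM; last by apply: (cvg_comp _ _ xid); exact: continuous_sin.
  apply: cvgM; last exact: cvg_cst.
  by apply: cvgD; apply: (exp_c) => //; exact: cvgN.
have al_c : (fun x => A x * P x delta + B x * Q x delta) @ k -->
   A k * P k delta + B k * Q k delta by apply: cvgD; exact: cvgM.
have be_c : (fun x => B x * P x delta - A x * Q x delta) @ k -->
   B k * P k delta - A k * Q k delta by apply: cvgB; exact: cvgM.
rewrite /continuous_at /F.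
apply: cvgM.
  by apply: (exp_c); apply: cvgN; apply: cvgM => //; exact: cvg_cst.
have H_c (u v : R -> R) : u @ k --> u k -> v @ k --> v k ->
    (fun x => u x ^+ 2 + v x ^+ 2
      + Num.sqrt ((1 + u x ^+ 2 - v x ^+ 2) ^+ 2 + 4 * u x ^+ 2 * v x ^+ 2)) @ k
    --> u k ^+ 2 + v k ^+ 2
      + Num.sqrt ((1 + u k ^+ 2 - v k ^+ 2) ^+ 2 + 4 * u k ^+ 2 * v k ^+ 2).
  move=> u_c v_c; apply: cvgD; first by apply: cvgD; apply: (pow_c).
  apply: (sqrt_c (fun x => (1 + u x ^+ 2 - v x ^+ 2) ^+ 2 + 4 * u x ^+ 2 * v x ^+ 2)).
  apply: cvgD.
    apply: (pow_c); apply: cvgB; last by apply: (pow_c).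
    by apply: cvgD; [exact: cvg_cst|exact: pow_c].
  by apply: cvgM; [apply: cvgM; [exact: cvg_cst|exact: pow_c]|exact: pow_c].
apply: cvgD; first exact: H_c al_c be_c.
apply: (sqrt_c); apply: cvgB; last exact: cvg_cst.
by apply: (pow_c); exact: H_c al_c be_c.
Qed.

(** The extreme value theorem gives a maximum on [[sqrt b, sqrt a]]. It is at least 1, while the
    factor is at most 1 in the two outer regimes. *)
Lemma rho_cla_has_max delta : 0 < delta ->
  exists m, is_maximum (fun k => rho_cla k omega Cp Cs delta) m.
Proof.
move=> d0.
have rhoF k : b <= k ^+ 2 -> k ^+ 2 <= a -> rho_cla k omega Cp Cs delta = F delta k.
  by move=> bk ka; rewrite rho_cla_mid// amplifE.
have sab : Num.sqrt b <= Num.sqrt a by rewrite ler_wsqrtr// ltW.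
have itvP k : k \in `[Num.sqrt b, Num.sqrt a] -> b <= k ^+ 2 /\ k ^+ 2 <= a.
  rewrite in_itv /= => /andP[h1 h2].
  have sb0 := sqrtr_ge0 b.
  have eb : Num.sqrt b ^+ 2 = b by rewrite sqr_sqrtr// ltW.
  have ea : Num.sqrt a ^+ 2 = a by rewrite sqr_sqrtr// ltW// (lt_trans b0).
  by split; nra.
have [] := @EVT_max R (F delta) _ _ sab.
  apply: continuous_in_subspaceT => k; rewrite inE /= => kab.
  by apply: F_continuous; case: (itvP k kab).
move=> c cab cmax; exists (F delta c); split.
  by exists c; have [? ?] := itvP c cab; exact: rhoF.
(* At the endpoint [sqrt b] one has [eta = 0]: there is no decay, and the amplification is at least
   1. *)
have F1 : 1 <= F delta c.
  apply: le_trans (cmax (Num.sqrt b) _); last by rewrite in_itv /= lexx.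
  have eb : Num.sqrt b ^+ 2 = b by rewrite sqr_sqrtr// ltW.
  rewrite -rhoF ?eb//; last exact: ltW.
  rewrite rho_cla_mid ?eb//; last exact: ltW.
  rewrite /eta eb subrr sqrtr0 mulr0 oppr0 expR0 mul1r.
  apply: le_trans (amplif_ge _ _).
  by rewrite lerDl mulr_ge0.
move=> k.
have [kb|bk] := leP (k ^+ 2) b; first exact: le_trans (rho_cla_low _ _ _ _ kb) F1.
have [ak|ka] := leP a (k ^+ 2); first exact: le_trans (rho_cla_high _ _ _ d0 ak) F1.
(* The factor depends on [k] only through [k^2], which reduces negative [k] to the interval. *)
have kE : `|k| ^+ 2 = k ^+ 2 by rewrite real_normK ?num_real.
have kCE : (`|k|)%:C ^+ 2 = k%:C ^+ 2 by rewrite -[LHS]rmorphXn kE rmorphXn.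
have -> : rho_cla k omega Cp Cs delta = rho_cla `|k| omega Cp Cs delta.
  rewrite /rho_cla /r_plus /r_minus /schwarz_X /schwarz_E /lambda1 /lambda2.
  by rewrite kCE kE.
rewrite rhoF ?kE; [|exact: ltW|exact: ltW].
by apply: cmax; rewrite in_itv /= -!sqrtr_sqr !ler_wsqrtr// ltW.
Qed.

End IntermediateRegime.

(** * Maximising the growth coefficient *)

Section Expansion.
Variables (R : realType) (omega Cp Cs : R).
Hypotheses (omega_gt0 : 0 < omega) (Cs_gt0 : 0 < Cs) (Cs_lt_Cp : Cs < Cp).
Implicit Types k delta : R.

Let a : R := omega ^+ 2 / Cs ^+ 2.
Let b : R := omega ^+ 2 / Cp ^+ 2.

Let b0 : 0 < b := pressure_cutoff_gt0 omega_gt0 Cs_gt0 Cs_lt_Cp.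
Let ab : b < a := pressure_cutoff_lt_shear_cutoff omega_gt0 Cs_gt0 Cs_lt_Cp.

(** With [k^2 = b + t^2] the quartic terms of the denominator cancel. *)
Lemma growthE k : b <= k ^+ 2 -> k ^+ 2 <= a ->
  growth omega Cp Cs k =
  2 * b * Num.sqrt (k ^+ 2 - b) * (a - b - (Num.sqrt (k ^+ 2 - b)) ^+ 2) /
  ((a + b) * (Num.sqrt (k ^+ 2 - b)) ^+ 2 + b ^+ 2).
Proof.
move=> bk ka; rewrite /growth -/a -/b.
have -> : Num.sqrt (a - k ^+ 2) ^+ 2 = a - k ^+ 2 by rewrite sqr_sqrtr ?subr_ge0.
have e : Num.sqrt (k ^+ 2 - b) ^+ 2 = k ^+ 2 - b by rewrite sqr_sqrtr ?subr_ge0.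
rewrite e; congr (_ * _ / _); ring.
Qed.

Section Maximiser.
Variable x : R.
(** [x_crit] says that the derivative of the growth coefficient in [t] vanishes at [x]. *)
Hypotheses (x_gt0 : 0 < x)
  (x_crit : (a + b) * x ^+ 4 + ((a + b) * (a - b) + 3 * b ^+ 2) * x ^+ 2
            = b ^+ 2 * (a - b)).

(** The critical value, which [x_crit] brings to this polynomial form. *)
Let c : R := x * (x ^+ 2 + (a - b)) / b.

(* [x] is a double root of the cubic [c ((a + b) y^2 + b^2) - 2 b y (a - b - y^2)] *)
Lemma cubic_double_root (y : R) :
  c * ((a + b) * y ^+ 2 + b ^+ 2) - 2 * b * y * (a - b - y ^+ 2) =
  (y - x) ^+ 2 * (2 * b * y + b * (x ^+ 2 + (a - b)) / x).
Proof.
apply/eqP; rewrite -subr_eq0; apply/eqP.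
transitivity (y ^+ 2 * ((a + b) * x ^+ 4 + ((a + b) * (a - b) + 3 * b ^+ 2) * x ^+ 2
            - b ^+ 2 * (a - b)) / (b * x)); last by rewrite x_crit subrr mulr0 mul0r.
rewrite /c; move: (a) (b) (b0) => a' b' b'0; field.
by rewrite !gt_eqF.
Qed.

(** In the factored cubic the linear factor is positive for [y >= 0]. *)
Lemma growth_le k : b <= k ^+ 2 -> k ^+ 2 <= a -> growth omega Cp Cs k <= c.
Proof.
move=> bk ka; rewrite growthE//.
set y := Num.sqrt _; have y0 : 0 <= y := sqrtr_ge0 _.
have dpos : 0 < (a + b) * y ^+ 2 + b ^+ 2.
  rewrite ltr_wpDl ?exprn_gt0// mulr_ge0 ?sqr_ge0// ltW// addr_gt0//.
  exact: lt_trans ab.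
rewrite ler_pdivrMr// -subr_ge0 cubic_double_root.
have mp : 0 < a - b by rewrite subr_gt0.
apply: mulr_ge0; first exact: sqr_ge0.
apply: addr_ge0; first by
  rewrite -mulrA; apply: mulr_ge0 => //; apply: mulr_ge0 => //; exact: ltW.
apply: divr_ge0; last exact: ltW.
by apply: mulr_ge0; [exact: ltW|rewrite addr_ge0 ?sqr_ge0// ltW].
Qed.

Lemma growth_attained : exists k,
  [/\ b <= k ^+ 2, k ^+ 2 <= a & growth omega Cp Cs k = c].
Proof.
have mp : 0 < a - b by rewrite subr_gt0.
have x2 : 0 < x ^+ 2 by rewrite exprn_gt0.
have b2 : 0 < b ^+ 2 by rewrite exprn_gt0.
have nn : 0 < a + b by rewrite addr_gt0// (lt_trans b0).
(* Keeping only the term [3 b^2 x^2] on the left of [x_crit] shows that [k^2 = b + x^2] stays below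
   [a]. *)
have xm : 3 * x ^+ 2 <= a - b.
  rewrite -(ler_pM2l b2) -x_crit.
  have h1 : 0 <= (a + b) * x ^+ 4 by rewrite mulr_ge0 ?exprn_ge0 ?ltW.
  have h2 : 0 <= (a + b) * (a - b) * x ^+ 2 by rewrite !mulr_ge0 ?ltW.
  rewrite -subr_ge0.
  rewrite (_ : _ - _ = (a + b) * x ^+ 4 + (a + b) * (a - b) * x ^+ 2); last by ring.
  exact: addr_ge0.
have kE : Num.sqrt (b + x ^+ 2) ^+ 2 = b + x ^+ 2 by rewrite sqr_sqrtr// addr_ge0// ltW.
have bk : b <= b + x ^+ 2 by rewrite lerDl ltW.
have ka : b + x ^+ 2 <= a by lra.
exists (Num.sqrt (b + x ^+ 2)); rewrite kE; split => //.
rewrite growthE ?kE// addrC addKr sqrtr_sqr (gtr0_norm x_gt0).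
have dpos : 0 < (a + b) * x ^+ 2 + b ^+ 2 by rewrite addr_gt0// mulr_gt0.
apply: (canLR (mulfK (lt0r_neq0 dpos))).
have := cubic_double_root x; rewrite subrr expr0n mul0r => /eqP.
by rewrite subr_eq0 => /eqP <-.
Qed.

(** The lower bound evaluates the factor where [growth] is maximal; the upper bound uses the uniform
    expansion between the cutoffs and [1 <= 1 + c delta] elsewhere. *)
Lemma maximum_expansion delta m : 0 < delta -> Num.sqrt a * delta <= 1 / 16 ->
  is_maximum (fun k => rho_cla k omega Cp Cs delta) m ->
  `|m - (1 + c * delta)| <= 54 * a * delta ^+ 2.
Proof.
move=> d0 ad [[k km] mmax].
have approx k' (bk : b <= k' ^+ 2) (ka : k' ^+ 2 <= a) :=
  rho_cla_mid_approx omega_gt0 Cs_gt0 Cs_lt_Cp bk ka d0 ad.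
have mp : 0 < a - b by rewrite subr_gt0.
have c0 : 0 <= c.
  apply: divr_ge0; last exact: ltW.
  by apply: mulr_ge0; [exact: ltW|rewrite addr_ge0 ?sqr_ge0// ltW].
have err0 : 0 <= 54 * a * delta ^+ 2.
  by apply: mulr_ge0; rewrite ?sqr_ge0// mulr_ge0// ltW// (lt_trans b0).
have cd0 : 0 <= c * delta by rewrite mulr_ge0// ltW.
rewrite ler_norml; apply/andP; split.
  have [k' [bk ka kc]] := growth_attained.
  have := approx _ bk ka; rewrite kc ler_norml => /andP[h _].
  have := mmax k'; move: h; rewrite -/a; lra.
suff : m <= 1 + c * delta + 54 * a * delta ^+ 2 by lra.
rewrite -km.
have [kb|bk] := leP (k ^+ 2) b.
  by have := rho_cla_low omega_gt0 Cs_gt0 Cs_lt_Cp delta kb; lra.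
have [ak|ka] := leP a (k ^+ 2).
  by have := rho_cla_high omega_gt0 Cs_gt0 Cs_lt_Cp d0 ak; lra.
have := approx _ (ltW bk) (ltW ka); rewrite ler_norml => /andP[_]; rewrite -/a => h.
have : growth omega Cp Cs k * delta <= c * delta.
  by rewrite ler_pM2r// growth_le// ltW.
lra.
Qed.

End Maximiser.

End Expansion.

(** * Closed form of the critical point and of the constant *)

Lemma critical_point (R : realType) (omega Cp Cs : R) :
  0 < omega -> 0 < Cs -> Cs < Cp ->
  let a := omega ^+ 2 / Cs ^+ 2 in
  let b := omega ^+ 2 / Cp ^+ 2 in
  let S := Num.sqrt (Cp ^+ 4 + 8 * Cs ^+ 4) in
  let P := Cp ^+ 2 * S - Cp ^+ 4 - 2 * Cs ^+ 4 in
  let x := omega * Num.sqrt P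
    / (Num.sqrt 2 * Cs * Cp * Num.sqrt (Cp ^+ 2 + Cs ^+ 2)) in
  [/\ 0 < x,
      (a + b) * x ^+ 4 + ((a + b) * (a - b) + 3 * b ^+ 2) * x ^+ 2
        = b ^+ 2 * (a - b) &
      (Num.sqrt 2 * Cs * omega * (3 * Cp ^+ 2 - S) * Num.sqrt P)
        / (Cp * (Cp ^+ 2 + Cs ^+ 2) `^ (3 / 2) * (S - Cp ^+ 2))
      = x * (x ^+ 2 + (a - b)) / b].
Proof.
move=> omega0 Cs0 Csp a b S P x.
have Cp0 : 0 < Cp := lt_trans Cs0 Csp.
set p := Cp ^+ 2 in S P x *.
set q := Cs ^+ 2 in S P x *.
have p0 : 0 < p by rewrite exprn_gt0.
have q0 : 0 < q by rewrite exprn_gt0.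
have pq0 : 0 < p + q by rewrite addr_gt0.
have qp : q < p by rewrite ltr_pXn2r// nnegrE ltW.
have S2 : S ^+ 2 = p ^+ 2 + 8 * q ^+ 2.
  rewrite sqr_sqrtr; first by rewrite /p /q; ring.
  by apply: addr_ge0; [|apply: mulr_ge0 => //]; apply: exprn_ge0; exact: ltW.
have S0 : 0 <= S := sqrtr_ge0 _.
have PE : P = p * S - p ^+ 2 - 2 * q ^+ 2 by rewrite /P /p /q; ring.
have Sp : p < S.
  rewrite -(@ltr_pXn2r _ 2)// ?nnegrE// ?(ltW p0)// S2 ltrDl.
  by rewrite mulr_gt0// exprn_gt0.
(* Squaring [P + (p^2 + 2 q^2) = p S] gives a quadratic for [P]: the critical equation up to
   scaling. It also forces [P > 0]. *)
have hP : P ^+ 2 + 2 * P * (p ^+ 2 + 2 * q ^+ 2) = 4 * q ^+ 2 * (p ^+ 2 - q ^+ 2).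
  transitivity (p ^+ 2 * S ^+ 2 - (p ^+ 2 + 2 * q ^+ 2) ^+ 2).
    by rewrite PE; ring.
  by rewrite S2; ring.
have P0 : 0 < P.
  have q20 : 0 < q ^+ 2 by rewrite exprn_gt0.
  have p20 : q ^+ 2 < p ^+ 2 by rewrite ltr_pXn2r// nnegrE ltW.
  have pS : 0 <= p * S by rewrite mulr_ge0// ltW.
  have f0 : 0 < P + 2 * (p ^+ 2 + 2 * q ^+ 2) by rewrite PE; lra.
  rewrite -(pmulr_lgt0 _ f0).
  have -> : P * (P + 2 * (p ^+ 2 + 2 * q ^+ 2)) = 4 * q ^+ 2 * (p ^+ 2 - q ^+ 2).
    by rewrite -hP; ring.
  by rewrite mulr_gt0 ?subr_gt0// mulr_gt0.
have w2 : Num.sqrt 2 ^+ 2 = 2 :> R by rewrite sqr_sqrtr.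
have r2 : Num.sqrt (p + q) ^+ 2 = p + q by rewrite sqr_sqrtr// ltW.
have g2 : Num.sqrt P ^+ 2 = P by rewrite sqr_sqrtr// ltW.
have w0 : 0 < Num.sqrt 2 :> R by rewrite sqrtr_gt0.
have r0 : 0 < Num.sqrt (p + q) by rewrite sqrtr_gt0.
have g0 : 0 < Num.sqrt P by rewrite sqrtr_gt0.
have x0 : 0 < x by apply: divr_gt0; rewrite ?mulr_gt0.
have xE : x ^+ 2 = omega ^+ 2 * P / (2 * p * q * (p + q)).
  have -> : x ^+ 2 = omega ^+ 2 * Num.sqrt P ^+ 2 /
      (Num.sqrt 2 ^+ 2 * Cs ^+ 2 * Cp ^+ 2 * Num.sqrt (p + q) ^+ 2).
    by rewrite /x !(exprMn, exprVn).
  by rewrite w2 r2 g2 -/p -/q; congr (_ / _); ring.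
split=> //.
- have -> : x ^+ 4 = (x ^+ 2) ^+ 2 by ring.
  rewrite xE /a /b -/p -/q; apply/eqP; rewrite -subr_eq0; apply/eqP.
  transitivity (omega ^+ 6 / (4 * p ^+ 3 * q ^+ 3 * (p + q)) *
    (P ^+ 2 + 2 * P * (p ^+ 2 + 2 * q ^+ 2) - 4 * q ^+ 2 * (p ^+ 2 - q ^+ 2))).
    by clearbody x P S p q; field; rewrite !gt_eqF.
  by rewrite hP subrr mulr0.
have -> : (p + q) `^ (3 / 2) = (p + q) * Num.sqrt (p + q).
  have -> : 3 / 2 = 1 + 2^-1 :> R by field.
  rewrite powRD; last by rewrite (gt_eqF pq0) implybT.
  by rewrite powRr1 ?powR12_sqrt// ltW.
have xm : (x ^+ 2 + (a - b)) / b = (p * S + p ^+ 2 - 4 * q ^+ 2) / (2 * q * (p + q)).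
  rewrite xE /a /b -/p -/q PE.
  by clearbody x P S p q; field; rewrite !gt_eqF.
have key : 4 * q ^+ 2 * (3 * p - S) = (S - p) * (p * S + p ^+ 2 - 4 * q ^+ 2).
  transitivity (p * S ^+ 2 - p ^+ 3 - 4 * q ^+ 2 * (S - p)); last by ring.
  by rewrite S2; ring.
have Sp0 : 0 < S - p by rewrite subr_gt0.
rewrite -[RHS]mulrA xm.
have -> : p * S + p ^+ 2 - 4 * q ^+ 2 = 4 * q ^+ 2 * (3 * p - S) / (S - p).
  by rewrite key [X in X / _]mulrC mulfK// gt_eqF.
have -> : Num.sqrt 2 * Cs * omega * (3 * p - S) * Num.sqrt P /
    (Cp * ((p + q) * Num.sqrt (p + q)) * (S - p)) =
  x * (Num.sqrt 2 ^+ 2 * Cs ^+ 2 * (3 * p - S) / ((p + q) * (S - p))).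
  rewrite /x; move: w0 r0 Sp0 pq0.
  move: (Num.sqrt 2) (Num.sqrt (p + q)) (Num.sqrt P) (p + q) (S - p) (3 * p - S).
  by move=> w r g n d e w0 r0 d0 n0; field; rewrite !gt_eqF.
congr (_ * _); rewrite w2 -/q; move: pq0 Sp0.
move: (p + q) (S - p) (3 * p - S) => n d e n0 d0.
by field; rewrite !gt_eqF.
Qed.

(** * The expansion for small overlap *)

Theorem theorem2 (R : realType) (lambda mu rho omega : R)
    (lambda_gt0 : 0 < lambda) (mu_gt0 : 0 < mu)
    (rho_gt0 : 0 < rho) (omega_gt0 : 0 < omega) :
  let Cp := speed_p lambda mu rho in
  let Cs := speed_s mu rho in
  let S := Num.sqrt (Cp ^+ 4 + 8 * Cs ^+ 4) in
  let c := (Num.sqrt 2 * Cs * omega * (3 * Cp ^+ 2 - S)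
              * Num.sqrt (Cp ^+ 2 * S - Cp ^+ 4 - 2 * Cs ^+ 4))
           / (Cp * (Cp ^+ 2 + Cs ^+ 2) `^ (3 / 2) * (S - Cp ^+ 2)) in
  exists M : R -> R,
    (forall delta : R, 0 < delta ->
       is_maximum (fun k : R => rho_cla k omega Cp Cs delta) (M delta)) /\
    (fun delta : R => M delta - (1 + c * delta) : R^o)
      =o_ (0^'+) (fun delta : R => delta : R^o).
Proof.
move=> Cp Cs S c.
have Cs0 : 0 < Cs by rewrite sqrtr_gt0 divr_gt0.
have Csp : Cs < Cp.
  rewrite ltr_sqrt; last by rewrite divr_gt0// addr_gt0// mulr_gt0.
  by rewrite ltr_pM2r ?invr_gt0//; lra.
have [x0 x_crit cE] := critical_point omega_gt0 Cs0 Csp.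
(* For [delta <= 0] the condition is vacuous and any value serves. *)
have /choice[M MP] : forall delta, exists m, 0 < delta ->
    is_maximum (fun k : R => rho_cla k omega Cp Cs delta) m.
  move=> delta; have [d0|_] := ltP 0 delta; last by exists 0.
  by have [m] := rho_cla_has_max omega_gt0 Cs0 Csp d0; exists m.
exists M; split=> //; apply/eqoP => eps eps0.
set a := omega ^+ 2 / Cs ^+ 2 in x_crit cE.
have a0 : 0 < a by rewrite divr_gt0// exprn_gt0.
have sa0 : 0 < Num.sqrt a by rewrite sqrtr_gt0.
have a54 : 0 < 54 * a by rewrite mulr_gt0.
near=> delta.
have d0 : 0 < delta by near: delta; exact: nbhs_right_gt.
have ad : Num.sqrt a * delta <= 1 / 16.
  rewrite mulrC -ler_pdivlMr//; near: delta.
  by apply: nbhs_right_le; rewrite !divr_gt0.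
(* This makes the quadratic error at most [eps delta]. *)
have ed : 54 * a * delta <= eps.
  rewrite mulrC -ler_pdivlMr//; near: delta.
  by apply: nbhs_right_le; rewrite divr_gt0.
rewrite /= /c cE.
apply: le_trans (maximum_expansion omega_gt0 Cs0 Csp x0 x_crit d0 ad (MP _ d0)) _.
by rewrite (gtr0_norm d0) -/a [delta ^+ 2]expr2 mulrA ler_pM2r.
Unshelve. all: by end_near.
Qed.
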